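(* Let $m\ge 2$ be an integer and let $x_1,x_2\in\mathbb{N}\cup\{0\}$ satisfy $$1+\binom{x_1-1}{1}+\binom{x_1-1}{2}+\binom{x_1-1}{3}<2^m$$ and $$x_2=2^m-1-x_1-\binom{x_1}{2}\ge 0.$$ Then there exists a vector of weights $\pi=(\pi_1,\dots,\pi_n)\in\mathbb{N}^n$, $n=2^m-1$, having exactly $x_1$ coordinates of weight $1$ and exactly $x_2$ coordinates of weight $2$ (that is, $|\{i:\pi_i=1\}|=x_1$ and $|\{i:\pi_i=2\}|=x_2$), such that the binary Hamming code $\mathcal{H}_m$ is a $2$-perfect $\pi$-code.
   Context: $\mathbb{N}$ denotes the positive integers and $\binom{a}{j}=a(a-1)\cdots(a-j+1)/j!$. For a vector of weights $\pi=(\pi_1,\dots,\pi_n)\in\mathbb{N}^n$, the $\pi$-weight of $\mathbf{x}=(x_1,\dots,x_n)\in\mathbb{F}_2^n$ is $w_\pi(\mathbf{x})=\sum_{i=1}^n\pi_i x_i$ (with the entries $x_i$ regarded as integers $0,1$), the $\pi$-distance is $d_\pi(\mathbf{x},\mathbf{y})=w_\pi(\mathbf{x}-\mathbf{y})$, and $S_\pi(\mathbf{x};r)=\{\mathbf{y}\in\mathbb{F}_2^n: d_\pi(\mathbf{x},\mathbf{y})\le r\}$. A subset $C\subset\mathbb{F}_2^n$ is an $r$-perfect $\pi$-code if the spheres $S_\pi(\mathbf{c};r)$, $\mathbf{c}\in C$, are mutually disjoint and their union is $\mathbb{F}_2^n$. The binary Hamming code $\mathcal{H}_m$ is the linear code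 of length $2^m-1$ over $\mathbb{F}_2$ whose parity check matrix is the $m\times(2^m-1)$ binary matrix $H_m$ whose $i$-th column is the binary representation of $i$, for $1\le i\le 2^m-1$. *)

(* Defs.v *)
From mathcomp Require Import all_boot all_order all_algebra.

Set Implicit Arguments.
Unset Strict Implicit.
Unset Printing Implicit Defensive.

Import Order.TTheory GRing.Theory Num.Theory.
Local Open Scope ring_scope.

(* The upper argument is a rational rather than a natural number because
   x_1 - 1 is -1 when x_1 = 0; 'C(_, _) with truncated subtraction would give
   other values there. *)
Definition gbinom (a : rat) (j : nat) : rat :=
  (\prod_(i < j) (a - i%:R)) / j`!%:R.

(* [x 0 i : nat] is the representative of x_i in {0, 1}. *)
Definition piweight (n : nat) (pi : {ffun 'I_n -> nat}) (x : 'rV['F_2]_n) : nat :=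
  (\sum_(i < n) pi i * (x 0%R i : nat))%N.

Definition pidist (n : nat) (pi : {ffun 'I_n -> nat}) (x y : 'rV['F_2]_n) : nat :=
  piweight pi (x - y).

Definition pisphere (n : nat) (pi : {ffun 'I_n -> nat}) (x : 'rV['F_2]_n)
    (r : nat) : {set 'rV['F_2]_n} :=
  [set y | (pidist pi x y <= r)%N].

Definition perfect_code (n : nat) (pi : {ffun 'I_n -> nat}) (r : nat)
    (C : {set 'rV['F_2]_n}) : Prop :=
  (forall c c' : 'rV['F_2]_n, c \in C -> c' \in C -> c != c' ->
     [disjoint pisphere pi c r & pisphere pi c' r]) /\
  \bigcup_(c in C) pisphere pi c r = [set: 'rV['F_2]_n].

(* Columns are numbered from 0, so column j holds the m binary digits of j + 1.
   The most significant digit is in the top row; the order of the rows does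
   not affect the code. *)
Definition hamming_mx (m : nat) : 'M['F_2]_(m, 2 ^ m - 1) :=
  \matrix_(k < m, j < 2 ^ m - 1) ((j.+1 %/ 2 ^ (m - k.+1)) %% 2)%:R.

Definition hamming_code (m : nat) : {set 'rV['F_2]_(2 ^ m - 1)} :=
  [set x | hamming_mx m *m x^T == 0].

(* Main.v *)
(** Choose [x1] columns of the parity check matrix, no four or fewer of which
    sum to zero; as in the Gilbert-Varshamov bound this can be done greedily,
    since the sums of at most three of the columns already chosen do not fill
    the whole space. Then the sums of at most two chosen columns are pairwise
    distinct. Give weight 1 to the chosen columns, weight 3 to the other columns
    that are sums of two chosen ones, and weight 2 to the rest. The vectors of
    weight at most 2 have pairwise distinct syndromes and realize every
    syndrome, so they tile the space when translated by the code. *)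
Require Import Defs.
From mathcomp Require Import all_boot all_order all_algebra.

Set Implicit Arguments.
Unset Strict Implicit.
Unset Printing Implicit Defensive.

Import Order.TTheory GRing.Theory Num.Theory.
Local Open Scope ring_scope.

(** * Binomial coefficients and binary digits *)

Lemma gbinom_nat (k j : nat) : gbinom k%:R j = ('C(k, j))%:R.
Proof.
have prodE : \prod_(i < j) (k%:R - i%:R) = (k ^_ j)%:R :> rat.
  elim: j => [|j IHj]; first by rewrite big_ord0 ffactn0.
  rewrite big_ord_recr /= {}IHj ffactnSr natrM.
  (* Truncated subtraction differs from the rational one only when [k < j], and then [k ^_ j] is
     already 0. *)
  case: (leqP j k) => [le_jk | lt_kj]; first by rewrite natrB.
  by rewrite ffact_small // !mul0r.
by rewrite /gbinom prodE -bin_ffact natrM mulfK // pnatr_eq0 -lt0n fact_gt0.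
Qed.

Lemma eq_binary_digits (m a b : nat) : (a < 2 ^ m)%N -> (b < 2 ^ m)%N ->
  (forall k, (k < m)%N -> (a %/ 2 ^ k) %% 2 = (b %/ 2 ^ k) %% 2)%N -> a = b.
Proof.
elim: m a b => [|m IHm] a b; first by rewrite expn0 !ltnS !leqn0 => /eqP-> /eqP->.
move=> lt_a lt_b eq_ab; rewrite (divn_eq a 2) (divn_eq b 2).
have := eq_ab 0%N isT; rewrite expn0 !divn1 => ->; congr (_ * _ + _)%N.
apply: IHm => [||k lt_km]; rewrite ?ltn_divLR -?expnSr //.
by rewrite -!divnMA -expnS eq_ab.
Qed.

Definition small_subsets (I : finType) (A : {set I}) (d : nat) : {set {set I}} :=
  [set E : {set I} | (E \subset A) && (#|E| <= d)%N].

Lemma card_small_subsets (I : finType) (A : {set I}) (d : nat) :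
  #|small_subsets A d| = (\sum_(j < d.+1) 'C(#|A|, j))%N.
Proof.
elim: d => [|d IHd].
  rewrite big_ord1 -cards_draws; apply: eq_card => E.
  by rewrite !inE leqn0.
rewrite big_ord_recr /= -IHd -cards_draws.
set B := [set E | _ & _].
have disjB : small_subsets A d :&: B = set0.
  apply/setP => E; rewrite !inE; apply/negP => /andP[/andP[_ le_d] /andP[_ /eqP eq_d]].
  by rewrite eq_d ltnn in le_d.
rewrite -cardsUI disjB cards0 addn0; apply: eq_card => E.
by rewrite !inE -andb_orr leq_eqVlt ltnS orbC.
Qed.

(** * Subset sums in a group where every element is its own opposite *)

Section SubsetSums.

Variables (I : finType) (V : finZmodType) (h : I -> V).
Hypothesis char2 : forall v : V, v + v = 0.

Definition subset_sum (E : {set I}) : V := \sum_(i in E) h i.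

(** In a vector space over the field of two elements, subset sums are all the linear combinations,
    so this is linear independence of any at most [d] vectors indexed by [A]. *)
Definition independent_upto (d : nat) (A : {set I}) : Prop :=
  forall E : {set I}, E \in small_subsets A d -> subset_sum E = 0 -> E = set0.

Lemma subset_sum1 (i : I) : subset_sum [set i] = h i.
Proof. exact: big_set1. Qed.

Lemma add_eq0_char2 (u v : V) : u + v = 0 -> u = v.
Proof. by move=> uv0; rewrite -[u]addr0 -(char2 v) addrA uv0 add0r. Qed.

(** If [E] and [F] have equal sums, cancelling the common part shows that their symmetric difference
    sums to zero; it has at most [d + d] elements, so it is empty. *)
Lemma subset_sum_inj (d : nat) (A : {set I}) : independent_upto (d + d) A ->
  {in small_subsets A d &, injective subset_sum}.
Proof.
move=> indep E F; rewrite !inE => /andP[sEA leE] /andP[sFA leF] eqEF.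
have disjD : [disjoint E :\: F & F :\: E].
  by rewrite -setI_eq0; apply/eqP/setP => i; rewrite !inE; do 2!case: (_ \in _).
have sym0 : (E :\: F) :|: (F :\: E) = set0.
  apply: indep.
    rewrite inE subUset !(subset_trans (subsetDl _ _)) //=.
    rewrite (leq_trans (leq_card_setU _ _)) // leq_add //;
      exact: leq_trans (subset_leq_card (subsetDl _ _)) _.
  rewrite /subset_sum (eq_bigl _ _ (fun i => in_setU i _ _)) bigU //=.
  suff -> : \sum_(i in E :\: F) h i = \sum_(i in F :\: E) h i by exact: char2.
  apply: (addrI (\sum_(i in E :&: F) h i)).
  by rewrite -big_setID [in RHS]setIC -big_setID.
apply/setP => i; move/setP/(_ i): sym0; rewrite !inE.
by do 2!case: (_ \in _).
Qed.

Hypothesis h_surj : forall v : V, v != 0 -> exists i, h i = v.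

(** Greedy step: add a vector that is not a sum of at most [d] chosen ones. A vanishing sum of at
    most [d.+1] vectors involving it would write it as such a sum. *)
Lemma independent_upto_exists (d k : nat) : (0 < d)%N ->
  (forall j, (j < k)%N -> (\sum_(i < d.+1) 'C(j, i) < #|V|)%N) ->
  exists2 A : {set I}, #|A| = k & independent_upto d.+1 A.
Proof.
move=> d_gt0; elim: k => [_|k IHk small].
  exists set0; first exact: cards0.
  by move=> E; rewrite inE subset0 => /andP[/eqP].
have [|A cardA indepA] := IHk; first by move=> j /ltnW; exact: small.
have few : (#|subset_sum @: small_subsets A d| < #|V|)%N.
  by rewrite (leq_ltn_trans (leq_imset_card _ _)) // card_small_subsets cardA small.
have /subsetPn[v _ v_new] :
    ~~ ([set: V] \subset subset_sum @: small_subsets A d).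
  by apply: contraTN few => /subset_leq_card; rewrite cardsT -leqNgt.
have v_neq0 : v != 0.
  apply: contraNneq v_new => ->; apply/imsetP; exists set0.
    by rewrite inE sub0set cards0.
  by rewrite /subset_sum big_set0.
have [i hi] := h_surj v_neq0.
(* Here [0 < d] enters: it makes singletons of [A] count among the small subsets. *)
have iA : i \notin A.
  apply: contra v_new => iA; apply/imsetP; exists [set i].
    by rewrite inE sub1set iA cards1.
  by rewrite subset_sum1.
exists (i |: A) => [|E]; first by rewrite cardsU1 iA cardA.
rewrite inE => /andP[sE leE] sum0.
case iE : (i \in E); last first.
  apply: indepA => //; rewrite inE leE andbT.
  apply/subsetP => j jE; have := subsetP sE j jE.
  by rewrite !inE; case: eqP => // eq_ji; rewrite -eq_ji jE in iE.
case/negP: v_new; apply/imsetP; exists (E :\ i).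
  rewrite inE subDset sE /=.
  by move: leE; rewrite (cardsD1 i) iE.
by rewrite -hi; apply/esym/add_eq0_char2; rewrite addrC -big_setD1.
Qed.

Hypotheses (h_inj : injective h) (h_neq0 : forall i, h i != 0).

(** * Weights attached to an independent set *)

Section Weights.

Variable A : {set I}.
Hypothesis indepA : independent_upto 4 A.

Let sums : {set V} := subset_sum @: small_subsets A 2.

(** The value 3 exceeds the radius 2, so such a coordinate lies in no set of weight at most 2. *)
Definition sum_weight : {ffun I -> nat} :=
  [ffun i => if i \in A then 1 else if h i \in sums then 3 else 2]%N.

Let sums_A (i : I) : i \in A -> h i \in sums.
Proof.
move=> iA; apply/imsetP; exists [set i]; last by rewrite subset_sum1.
by rewrite inE sub1set iA cards1.
Qed.

Lemma sum_weight_gt0 (i : I) : (0 < sum_weight i)%N.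
Proof. by rewrite ffunE; case: ifP => // _; case: ifP. Qed.

Lemma sum_weight1 : [set i | sum_weight i == 1%N] = A.
Proof. by apply/setP => i; rewrite inE ffunE; case: ifP => // _; case: ifP. Qed.

Lemma sum_weight_eq2 (i : I) : (sum_weight i == 2%N) = (h i \notin sums).
Proof.
rewrite ffunE; case: ifP => [iA | _]; last by case: ifP.
by rewrite sums_A.
Qed.

Let zero_sums : 0 \in sums.
Proof.
apply/imsetP; exists set0; first by rewrite inE sub0set cards0.
by rewrite /subset_sum big_set0.
Qed.

(** [h] maps the indices of weight 2 bijectively onto the complement of [sums], and distinct subsets
    of [A] of size at most 2 have distinct sums. *)
Lemma card_sum_weight2 :
  (#|[set i | sum_weight i == 2%N]| + (1 + #|A| + 'C(#|A|, 2)) = #|V|)%N.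
Proof.
rewrite -(card_imset _ h_inj).
have -> : h @: [set i | sum_weight i == 2%N] = ~: sums.
  apply/setP => v; rewrite inE; apply/imsetP/idP => [[i] | v_sums].
    by rewrite inE sum_weight_eq2 => ? ->.
  have [i hi] : exists i, h i = v.
    by apply: h_surj; apply: contraNneq v_sums => ->.
  by exists i; rewrite // inE sum_weight_eq2 hi.
have <- : #|sums| = (1 + #|A| + 'C(#|A|, 2))%N.
  rewrite card_in_imset; last exact: (@subset_sum_inj 2).
  by rewrite card_small_subsets !big_ord_recr big_ord0 /= bin0 bin1.
by rewrite addnC cardsC.
Qed.

(** An element outside [A] weighs at least 2, so it leaves no room for another one, and it cannot
    weigh 3. *)
Lemma light_subset (E : {set I}) : (\sum_(i in E) sum_weight i <= 2)%N ->
  E \in small_subsets A 2 \/ exists2 i, E = [set i] & h i \notin sums.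
Proof.
move=> light; have [sEA | /subsetPn[i iE iA]] := boolP (E \subset A).
  left; rewrite inE sEA; apply: leq_trans light.
  rewrite -sum1_card leq_sum // => i _; exact: sum_weight_gt0.
right; exists i.
  apply/eqP; rewrite eqEsubset sub1set iE andbT.
  apply/subsetP => j jE; rewrite inE; apply: contraTT light => ji.
  rewrite (big_setD1 i) //= (big_setD1 j) /= ?inE ?ji // -ltnNge.
  have := sum_weight_gt0 j; rewrite [sum_weight i]ffunE (negPf iA).
  by case: (sum_weight j) => // n _; case: ifP.
apply: contraTN light => hi; rewrite (big_setD1 i) //= -ltnNge.
by rewrite ffunE (negPf iA) hi.
Qed.

(** Two sets of different kinds in [light_subset] cannot have equal sums: one sum lies in [sums],
    the other does not. *)
Lemma light_subset_sum_inj (E F : {set I}) :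
  (\sum_(i in E) sum_weight i <= 2)%N -> (\sum_(i in F) sum_weight i <= 2)%N ->
  subset_sum E = subset_sum F -> E = F.
Proof.
move=> /light_subset[PE | [i -> Di]] /light_subset[PF | [j -> Dj]].
- exact: (@subset_sum_inj 2 A).
- rewrite subset_sum1 => eqE; case/negP: Dj.
  by rewrite -eqE; apply: imset_f.
- rewrite subset_sum1 => eqF; case/negP: Di.
  by rewrite eqF; apply: imset_f.
- by rewrite !subset_sum1 => /h_inj ->.
Qed.

Lemma light_subset_sum_surj (v : V) :
  exists2 E : {set I}, (\sum_(i in E) sum_weight i <= 2)%N & subset_sum E = v.
Proof.
have [/imsetP[E] | v_sums] := boolP (v \in sums).
  rewrite inE => /andP[sEA leE] ->; exists E => //.
  apply: leq_trans leE; rewrite -sum1_card leq_sum // => i iE.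
  by rewrite ffunE (subsetP sEA).
have [i hi] : exists i, h i = v.
  by apply: h_surj; apply: contraNneq v_sums => ->.
exists [set i]; last by rewrite subset_sum1.
by rewrite big_set1 eq_leq //; apply/eqP; rewrite sum_weight_eq2 hi.
Qed.

End Weights.

End SubsetSums.

Lemma F2_natE (a : 'F_2) : a = (a != 0)%:R.
Proof. by case: a => [[|[|[]]]] // lt_a; apply/val_inj. Qed.

Lemma F2_natr_eq (a b : nat) : a%:R = b%:R :> 'F_2 -> (a = b %[mod 2])%N.
Proof. by move/(congr1 val); rewrite /= !val_Fp_nat. Qed.

(** * Binary vectors as supports, and syndromes *)

Section Support.

Variable n : nat.

Definition support_set (x : 'rV['F_2]_n) : {set 'I_n} := [set i | x 0 i != 0].

Lemma support_set_inj : injective support_set.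
Proof.
move=> x y /setP eq_xy; apply/rowP => i.
by rewrite [x 0 i]F2_natE [y 0 i]F2_natE; have := eq_xy i; rewrite !inE => ->.
Qed.

Lemma support_set_surj (E : {set 'I_n}) : exists x, support_set x = E.
Proof.
exists (\row_i (i \in E)%:R); apply/setP => i; rewrite inE mxE.
by case: (i \in E).
Qed.

Lemma piweight_support (pi : {ffun 'I_n -> nat}) (x : 'rV['F_2]_n) :
  piweight pi x = (\sum_(i in support_set x) pi i)%N.
Proof.
rewrite /piweight [RHS]big_mkcond; apply: eq_bigr => i _.
by rewrite inE {1}[x 0 i]F2_natE; case: (x 0 i != 0); rewrite ?muln1 ?muln0.
Qed.

Lemma syndrome_support (m : nat) (H : 'M['F_2]_(m, n)) (x : 'rV['F_2]_n) :
  H *m x^T = subset_sum (fun i => col i H) (support_set x).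
Proof.
apply/colP => k; rewrite mxE summxE [RHS]big_mkcond; apply: eq_bigr => i _.
by rewrite inE !mxE {1}[x 0 i]F2_natE; case: (x 0 i != 0); rewrite ?mulr1 ?mulr0.
Qed.

(** If [y] is close to codewords [c] and [c'], then [c - y] and [c' - y] are light with the same
    syndrome, hence equal. For covering, adding to [y] a light vector of opposite syndrome gives a
    codeword. *)
Lemma perfect_code_of_syndromes (m r : nat) (H : 'M['F_2]_(m, n))
    (pi : {ffun 'I_n -> nat}) :
  (forall x y, (piweight pi x <= r)%N -> (piweight pi y <= r)%N ->
     H *m x^T = H *m y^T -> x = y) ->
  (forall v, exists2 x, (piweight pi x <= r)%N & H *m x^T = v) ->
  perfect_code pi r [set x | H *m x^T == 0].
Proof.
move=> inj surj; split=> [c c' | ].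
  rewrite !inE => /eqP Hc /eqP Hc' neq_c; rewrite -setI_eq0.
  apply/eqP/setP => y; rewrite !inE; apply: contra_neqF neq_c => /andP[dc dc'].
  by apply: (addIr (- y)); apply: inj; rewrite // !raddfB /= Hc Hc'.
apply/setP => y; rewrite in_setT; apply/bigcupP.
have [x wx Hx] := surj (- (H *m y^T)).
exists (y + x); first by rewrite inE !raddfD /= Hx subrr.
by rewrite inE /pidist [y + x]addrC addrK.
Qed.

End Support.

(** * The columns of the Hamming matrix are exactly the nonzero vectors *)

Section HammingColumns.

Variable m : nat.

Let h (i : 'I_(2 ^ m - 1)) : 'cV['F_2]_m := col i (hamming_mx m).

Lemma card_F2_cV : #|{: 'cV['F_2]_m}| = (2 ^ m)%N.
Proof. by rewrite card_mx card_Fp // muln1. Qed.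

Let ltS (i : 'I_(2 ^ m - 1)) : (i.+1 < 2 ^ m)%N.
Proof. by have := ltn_ord i; rewrite ltn_subRL add1n. Qed.

Let eq_of_digits (a b : nat) : (a < 2 ^ m)%N -> (b < 2 ^ m)%N ->
  (forall k : 'I_m, ((a %/ 2 ^ (m - k.+1)) %% 2)%:R
                  = ((b %/ 2 ^ (m - k.+1)) %% 2)%:R :> 'F_2) -> a = b.
Proof.
move=> lt_a lt_b eq_ab; apply: (@eq_binary_digits m) => // k lt_k.
(* The digit of [2 ^ k] stands in row [m - k.+1], the most significant digit being on top. *)
have lt_k' : (m - k.+1 < m)%N by rewrite ltn_subrL /= (leq_ltn_trans _ lt_k).
have /F2_natr_eq := eq_ab (Ordinal lt_k').
by rewrite !modn_mod /= -subSn // subSS subKn // ltnW.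
Qed.

Lemma hamming_col_inj : injective h.
Proof.
move=> i j eq_ij; apply/val_inj/succn_inj/eq_of_digits; try exact: ltS.
by move=> k; have /colP/(_ k) := eq_ij; rewrite !mxE.
Qed.

Lemma hamming_col_neq0 i : h i != 0.
Proof.
apply/eqP => hi0; suff: i.+1 = 0%N by [].
apply: eq_of_digits; rewrite ?expn_gt0 ?ltS // => k.
by have /colP/(_ k) := hi0; rewrite !mxE => ->; rewrite div0n mod0n.
Qed.

(** By counting: there are as many distinct nonzero columns as nonzero vectors. *)
Lemma hamming_col_surj v : v != 0 -> exists i, h i = v.
Proof.
move=> v0; suff: v \in h @: setT by case/imsetP=> i _ ->; exists i.
suff -> : h @: setT = [set~ 0] by rewrite !inE.
apply/eqP; rewrite eqEcard; apply/andP; split.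
  by apply/subsetP => _ /imsetP[i _ ->]; rewrite !inE hamming_col_neq0.
rewrite card_imset; last exact: hamming_col_inj.
by rewrite cardsT card_ord cardsC1 card_F2_cV subn1.
Qed.

End HammingColumns.

Theorem theorem2p2 (m x1 x2 : nat) (hm : (2 <= m)%N)
  (hx1 : 1 + gbinom (x1%:R - 1) 1 + gbinom (x1%:R - 1) 2
           + gbinom (x1%:R - 1) 3 < 2 ^+ m)
  (hx2 : x2%:R = 2 ^+ m - 1 - x1%:R - gbinom x1%:R 2) :
  exists pi : {ffun 'I_(2 ^ m - 1) -> nat},
    [/\ forall i, (0 < pi i)%N,
        #|[set i | pi i == 1%N]| = x1,
        #|[set i | pi i == 2%N]| = x2 &
        perfect_code pi 2 (hamming_code m)].
Proof.
pose h i := col i (hamming_mx m).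
have char2 (v : 'cV['F_2]_m) : v + v = 0.
  by apply/colP => k; rewrite !mxE; apply/val_inj; case: (v k 0) => [[|[|[]]]].
have few_sums j : (j < x1)%N -> (\sum_(i < 4) 'C(j, i) < #|{: 'cV['F_2]_m}|)%N.
  (* For [x1 = 0] there is no [j] to check. Otherwise [hx1] is the bound at the largest [j], namely
     [x1 - 1], and the sum is monotone in [j]. *)
  case: x1 hx1 {hx2} => // k; rewrite -natr1 addrK !gbinom_nat => hk.
  rewrite ltnS card_F2_cV => le_jk.
  apply: (@leq_ltn_trans (\sum_(i < 4) 'C(k, i))%N).
    by apply: leq_sum => i _; apply: leq_bin2l.
  rewrite -(ltr_nat rat) natrX !big_ord_recr big_ord0 /= bin0.
  by rewrite !natrD add0r.
have h_surj := @hamming_col_surj m.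
have h_inj := @hamming_col_inj m.
have [A cardA indepA] := independent_upto_exists char2 h_surj (isT : 0 < 3)%N few_sums.
exists (sum_weight h A); split; first exact: sum_weight_gt0.
- by rewrite sum_weight1.
- have := card_sum_weight2 char2 h_surj h_inj indepA; rewrite card_F2_cV cardA.
  (* The count is moved to the rationals, where the subtractions in [hx2] are not truncated. *)
  move/(congr1 (fun k => k%:R : rat)); rewrite !natrD natrX.
  move/(canRL (addrK _)); rewrite !opprD !addrA -gbinom_nat -hx2.
  by move/eqP; rewrite eqr_nat => /eqP.
- apply: perfect_code_of_syndromes => [x y | v].
    rewrite !piweight_support !syndrome_support => wx wy eq_xy.
    by apply: support_set_inj; apply: light_subset_sum_inj wx wy eq_xy.
  have [E wE <-] := light_subset_sum_surj h_surj A v.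
  have [x xE] := support_set_surj E.
  by exists x; rewrite ?piweight_support ?syndrome_support xE.
Qed.
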